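(* Let $V:\mathbb{R}^n\to\mathbb{R}$ be convex and $L$-smooth with $L>0$, let $x\in\mathbb{R}^n$ and $d\in\mathbb{R}^n$ with $\|d\|=1$ and $\langle\nabla V(x),d\rangle>0$. Put $f(\alpha):=V(x-\alpha d)-V(x)$, and for $\tau>0$ let $\alpha(\tau)$ denote the nonzero solution $\alpha$ of $f(\alpha)/\alpha^2=-1/\tau$. Then $\tau\mapsto f(\alpha(\tau))$ is decreasing for $\tau<2/L$ (that is, on the interval $(0,2/L)$).
   Context: $\|\cdot\|$ and $\langle\cdot,\cdot\rangle$ are the Euclidean norm and inner product. $V$ is $L$-smooth if it is continuously differentiable and $\|\nabla V(x)-\nabla V(y)\|\le L\|x-y\|$ for all $x,y\in\mathbb{R}^n$. For convex, continuously differentiable $V$ with $\langle\nabla V(x),d\rangle>0$, the equation $f(\alpha)/\alpha^2=-1/\tau$ has exactly one nonzero solution $\alpha(\tau)$ for each $\tau>0$, and it is positive. *)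

(* Defs.v *)
From HB Require Import structures.
From mathcomp Require Import all_boot all_order all_algebra.
From mathcomp Require Import all_classical all_reals all_analysis.

Set Implicit Arguments.
Unset Strict Implicit.
Unset Printing Implicit Defensive.

Import Order.TTheory GRing.Theory Num.Theory.
Import numFieldNormedType.Exports.

Local Open Scope classical_set_scope.
Local Open Scope ring_scope.

Definition dotprod (R : realType) (n : nat) (x y : 'rV[R]_n) : R :=
  \sum_(i < n) x 0 i * y 0 i.

(* The library norm `|x| on 'rV[R]_n is the sup norm, hence this definition.
   The two norms induce the same topology and the same differentials, so the
   library's continuous and differentiable are used as they are. *)
Definition enorm (R : realType) (n : nat) (x : 'rV[R]_n) : R :=
  Num.sqrt (dotprod x x).

Definition gradient (R : realType) (n : nat) (V : 'rV[R]_n -> R)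
    (x : 'rV[R]_n) : 'rV[R]_n :=
  \row_(i < n) 'D_(delta_mx 0 i) V x.

Definition continuously_differentiable (R : realType) (n : nat)
    (V : 'rV[R]_n -> R) : Prop :=
  (forall x, differentiable V x) /\ continuous (gradient V).

Definition smooth (R : realType) (n : nat) (L : R) (V : 'rV[R]_n -> R) : Prop :=
  continuously_differentiable V /\
  forall x y, enorm (gradient V x - gradient V y) <= L * enorm (x - y).

(* The nonzero solution a of f(a)/a^2 = -1/tau.  The default value 0 of xget is
   itself not a solution, and is returned only when there is none. *)
Definition step_size (R : realType) (f : R -> R) (tau : R) : R :=
  xget 0 [set a | a != 0 /\ f a / a ^+ 2 = - 1 / tau].

(* Main.v *)
(* Write a for alpha(tau), so that f(a) = - a^2 / tau.  As f is convex with
   f(0) = 0, the slope f(a) / a = - a / tau is nondecreasing in a, and hence a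
   increases with tau.  The descent lemma between a and 0 gives
   a f'(a) <= a^2 (L / 2 - 1 / tau), so f'(a) < 0 as long as tau < 2 / L.  For
   tau1 < tau2 < 2 / L the tangent of f at a2 therefore lies strictly above
   f(a2) at the smaller point a1, and by convexity f(a1) > f(a2). *)
Require Import Defs.
From HB Require Import structures.
From mathcomp Require Import all_boot all_order all_algebra.
From mathcomp Require Import all_classical all_reals all_analysis.
From mathcomp Require Import ring lra.

Import Order.TTheory GRing.Theory Num.Theory.
Import numFieldNormedType.Exports.

Local Open Scope classical_set_scope.
Local Open Scope ring_scope.

(** * Euclidean inner product and norm *)

Section Dotprod.
Context {R : realType} {n : nat}.
Implicit Types (u v w : 'rV[R]_n) (a : R).

Lemma dotprodC u v : dotprod u v = dotprod v u.
Proof. by apply: eq_bigr => i _; rewrite mulrC. Qed.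

Lemma dotprodDl u v w : dotprod (u + v) w = dotprod u w + dotprod v w.
Proof. by rewrite -big_split; apply: eq_bigr => i _; rewrite mxE mulrDl. Qed.

Lemma dotprodZl a u v : dotprod (a *: u) v = a * dotprod u v.
Proof. by rewrite mulr_sumr; apply: eq_bigr => i _; rewrite mxE mulrA. Qed.

Lemma dotprodBl u v w : dotprod (u - v) w = dotprod u w - dotprod v w.
Proof. by rewrite -scaleN1r dotprodDl dotprodZl mulN1r. Qed.

Lemma dotprodZr a u v : dotprod u (a *: v) = a * dotprod u v.
Proof. by rewrite dotprodC dotprodZl dotprodC. Qed.

Lemma dotprodBr u v w : dotprod w (u - v) = dotprod w u - dotprod w v.
Proof. by rewrite !(dotprodC w) dotprodBl. Qed.

Lemma dotprod_ge0 u : 0 <= dotprod u u.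
Proof. by apply: sumr_ge0 => i _; rewrite -expr2 sqr_ge0. Qed.

Lemma dotprod_eq0 u : dotprod u u = 0 -> u = 0.
Proof.
move/eqP; rewrite psumr_eq0 => [/allP u0|i _]; last by rewrite -expr2 sqr_ge0.
apply/rowP => i; have := u0 i; rewrite mem_index_enum mulf_eq0 orbb mxE.
by move=> /(_ isT)/eqP.
Qed.

Lemma enorm_ge0 u : 0 <= enorm u.
Proof. exact: sqrtr_ge0. Qed.

Lemma sqr_enorm u : enorm u ^+ 2 = dotprod u u.
Proof. by rewrite sqr_sqrtr // dotprod_ge0. Qed.

Lemma enormZ a u : enorm (a *: u) = `|a| * enorm u.
Proof.
by rewrite /enorm dotprodZl dotprodZr mulrA -expr2 sqrtrM ?sqr_ge0 // sqrtr_sqr.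
Qed.

(** Cauchy-Schwarz. For v nonzero, the squared norm of <v,v> u - <u,v> v equals <v,v> (<u,u> <v,v> -
    <u,v>^2), so the second factor is nonnegative. *)
Lemma dotprod_le_enorm u v : dotprod u v <= enorm u * enorm v.
Proof.
apply: le_trans (ler_norm _) _.
rewrite -(ler_pXn2r (n := 2)) ?nnegrE ?mulr_ge0 ?enorm_ge0 ?normr_ge0 //.
rewrite exprMn !sqr_enorm -normrX ger0_norm ?sqr_ge0 //.
have [/dotprod_eq0 ->|v0] := eqVneq (dotprod v v) 0.
  by rewrite -(scale0r 0) !dotprodZr !mul0r expr0n mulr0.
have vv : 0 < dotprod v v by rewrite lt_def v0 dotprod_ge0.
have := dotprod_ge0 (dotprod v v *: u - dotprod u v *: v).
rewrite !(dotprodBl, dotprodBr, dotprodZl, dotprodZr) (dotprodC v u) => h.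
rewrite -subr_ge0 -(pmulr_rge0 _ vv); apply: le_trans h _.
by rewrite le_eqVlt; apply/orP; left; apply/eqP; ring.
Qed.

End Dotprod.

(** * First-order inequalities for convex and for smooth functions *)

Lemma derive_gradient {R : realType} {n : nat} (V : 'rV[R]_n -> R)
    (x v : 'rV[R]_n) :
  differentiable V x -> 'D_v V x = dotprod (gradient V x) v.
Proof.
move=> dV; rewrite deriveE // {1}(row_sum_delta v) linear_sum.
by apply: eq_bigr => i _; rewrite linearZ mxE deriveE // mulrC.
Qed.

(** Both derivatives are limits of the same difference quotient, by [E]. *)
Lemma is_derive_line {R : realType} {W : normedModType R} (V : W -> R)
    (x v : W) (t : R) : differentiable V (x + t *: v) ->
  is_derive t 1 (fun s : R => V (x + s *: v)) ('D_v V (x + t *: v)).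
Proof.
move=> dV; have : derivable V (x + t *: v) v by exact: diff_derivable.
have E : (fun h : R => h^-1 *: (V (x + (h *: (1 : R) + t) *: v) - V (x + t *: v)))
       = (fun h : R => h^-1 *: (V (h *: v + (x + t *: v)) - V (x + t *: v))).
  by apply/funext => h; rewrite [h *: 1]mulr1 scalerDl addrCA.
move=> dVv; apply: DeriveDef; first by rewrite /derivable /= E.
by rewrite /derive /= E.
Qed.

(** Convexity on the segment from x to y bounds the difference quotient by V y - V x for 0 < h <= 1,
    and the bound survives the limit h -> 0+. *)
Lemma convex_above_tangent {R : realType} {n : nat} (V : 'rV[R]_n -> R)
    (x y : 'rV[R]_n) :
  convex_function [set: 'rV[R]_n] V -> differentiable V x ->
  V x + dotprod (gradient V x) (y - x) <= V y.
Proof.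
move=> cV dV; rewrite -lerBrDl -derive_gradient //.
have dr : (fun h : R => h^-1 *: (V (h *: (y - x) + x) - V x)) @ 0^'+
    --> 'D_(y - x) V x.
  by apply: cvg_dnbhs_at_right; exact: diff_derivable.
apply: (closed_cvg (fun r => r <= V y - V x)) dr; first exact: closed_le.
near=> h.
have h0 : 0 < h by [].
have h1 : h <= 1 by near: h; exact: nbhs_right_le.
have := cV (Itv01 (ltW h0) h1) y x; rewrite !in_setE => /(_ I I) cVh.
have {}cVh : V (h *: y + (1 - h) *: x) <= h * V y + (1 - h) * V x by exact: cVh.
have xE : h *: y + (1 - h) *: x = h *: (y - x) + x.
  by rewrite scalerBr scalerBl scale1r addrCA addrC.
rewrite xE in cVh.
rewrite [_ *: _]mulrC ler_pdivrMr //; lra.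
Unshelve. all: by end_near.
Qed.

Lemma smooth_descent {R : realType} {n : nat} {L : R} {V : 'rV[R]_n -> R}
    (x y : 'rV[R]_n) : smooth L V ->
  V y <= V x + dotprod (gradient V x) (y - x) + L / 2 * enorm (y - x) ^+ 2.
Proof.
move=> [[dV _] lipV]; set v := y - x; set g := dotprod _ v.
set c := L * enorm v ^+ 2.
(* The claim reads [psi 1 <= psi 0]; it follows from the mean value theorem once [dpsi] is
   nonpositive on the open interval (0, 1). *)
pose psi (s : R) := V (x + s *: v) - s * g - c / 2 * s ^+ 2.
pose dpsi s := dotprod (gradient V (x + s *: v)) v - g - c * s.
have dpsiP (s : R) : is_derive s (1 : R) psi (dpsi s).
  have H := is_derive_line V x v s (dV _).
  rewrite derive_gradient // in H.
  apply: is_derive_eq.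
  have scaleE (a b : R) : a *: b = a * b by [].
  by rewrite /dpsi !scaleE; move: (dotprod _ v) => D; field.
have [|s /[!in_itv]/= /andP[s0 s1] E] := MVT ltr01 (fun s _ => dpsiP s).
  by apply: derivable_within_continuous => s _; apply: ex_derive.
(* Cauchy-Schwarz and the Lipschitz bound, applied to points at distance s |v|, bound the gradient
   term by c s. *)
have : dpsi s <= 0.
  rewrite /dpsi /g -dotprodBl subr_le0.
  apply: le_trans (dotprod_le_enorm _ _) _.
  apply: le_trans (ler_wpM2r (enorm_ge0 _) (lipV _ _)) _.
  rewrite addrAC subrr add0r enormZ gtr0_norm // /c.
  by rewrite le_eqVlt; apply/orP; left; apply/eqP; ring.
move: E; rewrite /psi subr0 mulr1 scale1r scale0r addr0 addrCA subrr addr0 => <-.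
rewrite /c; lra.
Qed.

(** * The one-variable problem, with [df] in the role of the derivative of [f] *)

Section StepSize.
Context {R : realType} {L : R} {f df : R -> R}.
Hypothesis L_gt0 : 0 < L.
Hypothesis f_cont : continuous f.
Hypothesis f0 : f 0 = 0.
Hypothesis df0 : df 0 < 0.
Hypothesis tangent : forall s t, f s + df s * (t - s) <= f t.
Hypothesis descent :
  forall s t, f t <= f s + df s * (t - s) + L / 2 * (t - s) ^+ 2.

Lemma step_sizeP tau : 0 < tau ->
  0 < step_size f tau /\ f (step_size f tau) = - (step_size f tau ^+ 2 / tau).
Proof.
move=> tau0; have itau0 : 0 < tau^-1 by rewrite invr_gt0.
have fE a : a != 0 -> (f a / a ^+ 2 = - 1 / tau) <-> f a = - (a ^+ 2 / tau).
  move=> a0; have a20 : a ^+ 2 != 0 by rewrite expf_neq0.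
  split=> [e|->]; last by field; rewrite a0 gt_eqF.
  by rewrite -[f a](divfK a20) e; field; rewrite gt_eqF.
have [a] : exists a, [set a | a != 0 /\ f a / a ^+ 2 = - 1 / tau] a.
  (* f a + a^2 / tau is nonpositive at e by [descent], nonnegative at
     - df 0 * tau by [tangent], and so vanishes between these two points. *)
  pose e := - df 0 / (L / 2 + tau^-1).
  have k0 : 0 < L / 2 + tau^-1 by rewrite addr_gt0 ?divr_gt0.
  have e0 : 0 < e by rewrite divr_gt0 // oppr_gt0.
  have ke : (L / 2 + tau^-1) * e = - df 0 by rewrite mulrC mulfVK ?gt_eqF.
  have eb : e <= - df 0 * tau.
    rewrite ler_pM2l ?oppr_gt0 // -[leRHS]invrK lef_pV2 ?posrE //.
    by rewrite lerDr ltW ?divr_gt0.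
  pose h a := f a + a ^+ 2 / tau.
  have hc : continuous h.
    move=> a; apply: cvgD; first exact: f_cont.
    by apply: cvgMl; exact: exprn_continuous.
  have he : h e <= 0.
    have := descent 0 e; rewrite f0 subr0 /h => d1.
    suff : f e + e ^+ 2 / tau <= e * (df 0 + (L / 2 + tau^-1) * e).
      by rewrite ke subrr mulr0.
    lra.
  have hb : 0 <= h (- df 0 * tau).
    have := tangent 0 (- df 0 * tau); rewrite f0 subr0 /h => d1.
    have -> : (- df 0 * tau) ^+ 2 / tau = df 0 * df 0 * tau.
      by field; rewrite gt_eqF.
    lra.
  have [||c /[!in_itv]/= /andP[ec _] hc0] := @IVT _ h _ _ 0 eb.
  - exact: continuous_subspaceT.
  - by rewrite (min_idPl _) ?(max_idPr _) ?he ?hb // (le_trans he hb).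
  (* [h] vanishes at 0 as well; the positive left endpoint [e] excludes that zero. *)
  have c0 : c != 0 by rewrite gt_eqF // (lt_le_trans e0).
  by exists c; split=> //; apply/fE => //; apply/eqP; rewrite -addr_eq0 -/(h c) hc0.
move=> /(xgetI 0); rewrite -/(step_size f tau) => -[a0 /(fE _ a0) fa].
(* At a negative a the tangent at 0 gives f a >= df 0 * a > 0, whereas the equation makes f a
   nonpositive. *)
split=> //; rewrite lt_neqAle eq_sym a0 leNgt; apply/negP => an.
have := tangent 0 (step_size f tau); rewrite f0 subr0 fa.
have : 0 < df 0 * step_size f tau by rewrite nmulr_rgt0.
have : 0 <= step_size f tau ^+ 2 / tau by rewrite divr_ge0 ?sqr_ge0 // ltW.
lra.
Qed.

Lemma step_size_increasing tau1 tau2 : 0 < tau1 -> tau1 < tau2 ->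
  step_size f tau1 < step_size f tau2.
Proof.
move=> t1 t12; have t2 := lt_trans t1 t12.
have [a10 fa1] := step_sizeP _ t1; have [a20 fa2] := step_sizeP _ t2.
move: (step_size f tau1) (step_size f tau2) a10 a20 fa1 fa2 => a b a0 b0 fa fb.
rewrite ltNge; apply/negP => ba.
(* Weighting the tangent at b, taken at a and at 0, by b and a - b cancels [df b] and leaves the
   slope comparison f b / b <= f a / a. *)
have T1 := tangent b a; have T0 := tangent b 0; rewrite f0 in T0.
have : f b * a <= f a * b.
  have := ler_wpM2l (ltW b0) T1.
  have : (a - b) * (f b + df b * (0 - b)) <= (a - b) * 0.
    by apply: ler_wpM2l => //; rewrite subr_ge0.
  lra.
(* The slopes are - b / tau2 and - a / tau1, but b / tau2 <= a / tau2 < a / tau1. *)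
rewrite fa fb; apply/negP; rewrite -ltNge.
have -> : - (a ^+ 2 / tau1) * b = - (a * b * (a / tau1)) by ring.
have -> : - (b ^+ 2 / tau2) * a = - (a * b * (b / tau2)) by ring.
rewrite ltrN2 ltr_pM2l ?mulr_gt0 //.
apply: (@le_lt_trans _ _ (a / tau2)); first by rewrite ler_pM2r ?invr_gt0.
by rewrite ltr_pM2l // ltf_pV2 ?posrE.
Qed.

Lemma decreasing_at_step_size tau1 tau2 :
  0 < tau1 -> tau1 < tau2 -> tau2 < 2 / L ->
  f (step_size f tau2) < f (step_size f tau1).
Proof.
move=> t1 t12 t2L; have t2 := lt_trans t1 t12.
have ab := step_size_increasing _ _ t1 t12.
have [b0 fb] := step_sizeP _ t2.
move: (step_size f tau1) (step_size f tau2) ab b0 fb => a b ab b0 fb.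
have dfb : df b < 0.
  have := descent b 0; rewrite f0 fb sub0r sqrrN => D.
  (* The bound tau2 < 2 / L enters here: it makes the quadratic term of [D] smaller than b^2 /
     tau2. *)
  have it : L / 2 < tau2^-1.
    by rewrite -[ltLHS]invrK ltf_pV2 ?posrE ?invr_gt0 ?divr_gt0 // invf_div.
  have : 0 < b ^+ 2 * (tau2^-1 - L / 2).
    by rewrite mulr_gt0 ?exprn_gt0 // subr_gt0.
  rewrite -(pmulr_rlt0 _ b0); lra.
have := tangent b a.
have : 0 < df b * (a - b) by rewrite nmulr_rgt0 // subr_lt0.
lra.
Qed.

End StepSize.

Theorem lemma5p5 (R : realType) (n : nat) (L : R) (V : 'rV[R]_n -> R)
    (x d : 'rV[R]_n)
    (hL : 0 < L)
    (hconv : convex_function [set: 'rV[R]_n] V)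
    (hsmooth : smooth L V)
    (hd : enorm d = 1)
    (hgrad : 0 < dotprod (gradient V x) d) :
  let f : R -> R := fun a => V (x - a *: d) - V x in
  forall tau1 tau2 : R, 0 < tau1 -> tau1 < tau2 -> tau2 < 2 / L ->
    f (step_size f tau2) < f (step_size f tau1).
Proof.
move=> f; have dV := hsmooth.1.1.
have lineE s t : x - t *: d - (x - s *: d) = (s - t) *: d.
  by rewrite opprB addrC addrA subrK scalerBl.
(* The sign in [df] comes from moving along -d. *)
apply: (decreasing_at_step_size (L := L)
  (df := fun s => - dotprod (gradient V (x - s *: d)) d)) => //.
- move=> t; apply: cvgB; last exact: cvg_cst.
  apply: continuous_comp; last exact: differentiable_continuous.
  by apply: cvgB; [exact: cvg_cst|apply: cvgZl; exact: cvg_id].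
- by rewrite /f scale0r subr0 subrr.
- by rewrite scale0r subr0 oppr_lt0.
- move=> s t; have := convex_above_tangent V (x - s *: d) (x - t *: d) hconv (dV _).
  rewrite lineE dotprodZr /f; lra.
(* As d is a unit vector, the squared norm of (s - t) d is (t - s)^2, so [f] inherits the constant
   L. *)
- move=> s t; have := smooth_descent (x - s *: d) (x - t *: d) hsmooth.
  rewrite lineE dotprodZr enormZ hd mulr1 real_normK ?num_real // /f; lra.
Qed.
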